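(* Let $\mathcal{X}$ be a measurable space, let $k:\mathcal{X}\times\mathcal{X}\to\mathbb{R}$ be a measurable reproducing kernel with $|k(x,y)|\le 1$ for all $x,y$, let $\{\mathbb{P}_\theta:\theta\in\Theta\}$ be a family of Borel probability measures on $\mathcal{X}$, and let $\mathbb{P}^*_0$ be a Borel probability measure on $\mathcal{X}$ such that $\inf_{\theta\in\Theta}\mathrm{MMD}(\mathbb{P}_\theta,\mathbb{P}^*_0)=C$ for some $C>0$. Fix $\alpha>0$, an integer $T\ge1$ and a Borel probability measure $\mathbb{F}$ on $\mathcal{X}$. For each $n$, let $x_1,\dots,x_n$ be i.i.d. with law $\mathbb{P}^*_0$ and let $\nu_n$ be the approximate posterior defined in the context. Then for any sequence of positive reals $M_n\to+\infty$, \[ \nu_n\Big(\mathbb{P}:\ \mathrm{MMD}(\mathbb{P}_{\theta^*(\mathbb{P})},\mathbb{P}^*_0)>C+\frac{M_n}{n^{1/2}}\Big)\longrightarrow 0\quad (n\to\infty), \] where the convergence is in $L^1$, i.e. the expectation of the left-hand side with respect to $x_{1:n}\overset{\text{iid}}{\sim}\mathbb{P}^*_0$ tends to $0$.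
   Context: For a Borel probability measure $\mathbb{P}$ on $\mathcal{X}$, $\mu_{\mathbb{P}}=\int k(x,\cdot)\,\mathbb{P}(dx)$ in the RKHS $\mathcal{H}_k$ of $k$, and $\mathrm{MMD}(\mathbb{P},\mathbb{Q})=\|\mu_{\mathbb{P}}-\mu_{\mathbb{Q}}\|_{\mathcal{H}_k}$. $\theta^*(\mathbb{P})$ denotes a minimiser in $\arg\inf_{\theta\in\Theta}\mathrm{MMD}^2(\mathbb{P},\mathbb{P}_\theta)$ (assumed to exist and chosen measurably). Given data $x_{1:n}$, $\nu_n$ is the law of the random measure $\mathbb{P}=\sum_{i=1}^n w_i\delta_{x_i}+\sum_{k=1}^T\tilde w_k\delta_{\tilde x_k}$ with $\tilde x_{1:T}$ i.i.d. $\mathbb{F}$, independent of $(w_1,\dots,w_n,\tilde w_1,\dots,\tilde w_T)\sim\mathrm{Dirichlet}(1,\dots,1,\tfrac{\alpha}{T},\dots,\tfrac{\alpha}{T})$ ($n$ ones, $T$ copies of $\alpha/T$). Note that $\nu_n$ depends on the random data, so the left-hand side is a random variable. *)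

(* Defs.v *)
From HB Require Import structures.
From mathcomp Require Import all_boot all_order all_algebra.
From mathcomp Require Import all_classical all_reals all_analysis.
Set Implicit Arguments. Unset Strict Implicit. Unset Printing Implicit Defensive.
Import Order.TTheory GRing.Theory Num.Theory.
Import numFieldNormedType.Exports.
Local Open Scope classical_set_scope.
Local Open Scope ring_scope.

Section Defs.
Context (R : realType).

(* Iterated integral  \int mu(dx_0) \int mu(dx_1) ... \int mu(dx_{n-1}) f [x_0;..;x_{n-1}] ,
   i.e. integration against the n-fold product of mu (i.i.d. sampling). *)
Fixpoint iter_int d (T : measurableType d) (mu : {measure set T -> \bar R})
  (n : nat) (f : seq T -> \bar R) : \bar R :=
  match n with
  | 0 => f [::]
  | m.+1 => (\int[mu]_x iter_int mu m (fun s => f (x :: s)))%E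
  end.

Context d (X : measurableType d).

Definition kint (k : X -> X -> R) (P Q : probability X R) : R :=
  fine (\int[P]_x \int[Q]_y (k x y)%:E)%E.

(* MMD^2(P,Q) = || mu_P - mu_Q ||^2_{H_k}, expanded with the reproducing property *)
Definition MMD2 (k : X -> X -> R) (P Q : probability X R) : R :=
  kint k P P - 2 * kint k P Q + kint k Q Q.

Definition MMD (k : X -> X -> R) (P Q : probability X R) : R :=
  Num.sqrt (MMD2 k P Q).

Definition reproducing_kernel (k : X -> X -> R) : Prop :=
  (forall x y, k x y = k y x) /\
  (forall (m : nat) (x : 'I_m -> X) (c : 'I_m -> R),
      0 <= \sum_(i < m) \sum_(j < m) c i * c j * k (x i) (x j)).

Lemma nnpart_ge0 (w : R) : 0 <= Num.max w 0.
Proof. by rewrite le_max lexx orbT. Qed.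

Definition nnpart (w : R) : {nonneg R} := NngNum (nnpart_ge0 w).

Fixpoint wdirac (ws : seq (R * X)) : {measure set X -> \bar R} :=
  match ws with
  | [::] => mzero
  | (w, x) :: s => measure_add (mscale (nnpart w) (\d_x)) (wdirac s)
  end.

(* As a probability measure: equals sum_i w_i delta_{x_i} whenever the weights are
   nonnegative and sum to 1 (the Dirichlet-a.s. case); fallback Q otherwise. *)
Definition wdirac_prob (Q : probability X R) (ws : seq (R * X)) : probability X R :=
  mnormalize (wdirac ws) Q.

End Defs.

Section Dirichlet.
Context (R : realType).
Local Open Scope ereal_scope.

Definition simplex_complete (v : seq R) : seq R := rcons v (1 - \sum_(u <- v) u)%R.

Definition dir_dens (a : nat -> R) (w : seq R) : R :=
  if all (fun u => 0 < u)%R w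
  then (\prod_(i < size w) powR (nth 0 w i) (a i - 1))%R else 0%R.

Definition dir_const (a : nat -> R) (K : nat) : \bar R :=
  iter_int (@lebesgue_measure R) K.-1
    (fun v => (dir_dens a (simplex_complete v))%:E).

Definition dir_int (a : nat -> R) (K : nat) (h : seq R -> \bar R) : \bar R :=
  ((fine (dir_const a K))^-1)%:E *
  iter_int (@lebesgue_measure R) K.-1
    (fun v => h (simplex_complete v) * (dir_dens a (simplex_complete v))%:E).

End Dirichlet.

(* Main.v *)
(* If P_* is the minimiser for P, the triangle inequality of MMD gives
   MMD(P_*, P0) <= C + 2 MMD(P, P0), so by Markov's inequality it suffices that the mean of
   MMD^2(P, P0) is O(1/n). For P = sum_i W_i delta_{z_i} one has
   MMD^2(P, P0) = sum_{i,j} W_i W_j k0(z_i, z_j), with k0 the kernel centred at P0. With R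
   the total weight of the T auxiliary points and |k0| <= 4, the parallelogram inequality
   bounds this by twice the part over the n data points plus 8 R. Averaging over the Dirichlet
   weights and the iid data, the off-diagonal terms vanish, and
   E W_i^2 = 2 / ((n + alpha)(n + alpha + 1)), E R = alpha / (n + alpha). *)

Require Import Defs.
From HB Require Import structures.
From mathcomp Require Import all_boot all_order all_algebra.
From mathcomp Require Import all_classical all_reals all_analysis.
From mathcomp Require Import measurable_realfun ring lra.
Import Order.TTheory GRing.Theory Num.Theory.
Import numFieldNormedType.Exports.
Local Open Scope classical_set_scope.
Local Open Scope ring_scope.

(** Two obstacles shape the proof. [MMD] is given by double integrals, with no Hilbert space behind
    it, while the kernel is positive semidefinite only on finite families of points. Nonnegativity
    and Cauchy-Schwarz for measures are therefore obtained by replacing each measure by independent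
    draws and letting the number of draws grow. The Dirichlet law is given by an unnormalised
    density under iterated Lebesgue integrals. The data weights come first and have parameter 1, so
    integrating one of them out only involves a polynomial times a power of the remaining mass, and
    no Gamma function appears. The Beta integrals of the auxiliary weights are collected in one
    constant, which cancels against the normaliser. Both inductions, over the weights and over the
    iid data, carry an additional linear term: fixing one weight or one point turns its cross terms
    into a linear functional of the others. *)

Section Monotonicity.
Set Implicit Arguments. Unset Strict Implicit. Unset Printing Implicit Defensive.
Local Open Scope ereal_scope.
Context (R : realType) (d : measure_display) (T : measurableType d).
Import HBNNSimple.

(* The integral of a nonnegative function is a supremum over simple functions, so no
   measurability is needed: the posterior event is only ever bounded from above. *)
Lemma ge0_le_integral_nomeas (mu : {measure set T -> \bar R}) (f g : T -> \bar R) :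
  (forall x, 0 <= f x) -> (forall x, f x <= g x) ->
  \int[mu]_x f x <= \int[mu]_x g x.
Proof.
move=> f0 fg.
have g0 x : 0 <= g x by exact: le_trans (f0 x) (fg x).
rewrite !ge0_integralTE//; apply: ge_ereal_sup => _ [h/= hf] <-.
by apply: ereal_sup_ubound; exists h => //= x; exact: le_trans (hf x) (fg x).
Qed.

Lemma iter_int_ge0 (mu : {measure set T -> \bar R}) n (f : seq T -> \bar R) :
  (forall s, size s = n -> 0 <= f s) -> 0 <= iter_int mu n f.
Proof.
elim: n f => [|n IH] f f0 /=; first exact: f0.
by apply: integral_ge0 => x _; apply: IH => s sn; apply: f0; rewrite /= sn.
Qed.

Lemma le_iter_int (mu : {measure set T -> \bar R}) n (f g : seq T -> \bar R) :
  (forall s, size s = n -> 0 <= f s <= g s) ->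
  iter_int mu n f <= iter_int mu n g.
Proof.
elim: n f g => [|n IH] f g fg /=; first by have /andP[] := fg [::] erefl.
apply: ge0_le_integral_nomeas => x.
- by apply: iter_int_ge0 => s sn; have /andP[] := fg (x :: s) (congr1 S sn).
- by apply: IH => s sn; apply: fg; rewrite /= sn.
Qed.

Lemma eq_iter_int (mu : {measure set T -> \bar R}) n (f g : seq T -> \bar R) :
  (forall s, size s = n -> f s = g s) -> iter_int mu n f = iter_int mu n g.
Proof.
elim: n f g => [|n IH] f g fg /=; first exact: fg.
by apply: eq_integral => x _; apply: IH => s sn; apply: fg; rewrite /= sn.
Qed.

Lemma iter_int_cst (P : probability T R) n (c : R) :
  iter_int P n (fun=> c%:E) = c%:E.
Proof.
elim: n => //= n ->; rewrite integral_cst//= [P _]probability_setT mule1 //.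
Qed.

End Monotonicity.

(** * Integrals of powers of the remaining mass *)

Section PowerIntegrals.
Set Implicit Arguments. Unset Strict Implicit. Unset Printing Implicit Defensive.
Context (R : realType).
Local Notation mu := (@lebesgue_measure R).

(** Lebesgue measure equals [s] times its pushforward under multiplication by [s]: the two agree on
    half-open intervals, hence everywhere by uniqueness. *)
Lemma ge0_integral_scale (s : R) (f : R -> \bar R) : 0 < s ->
  measurable_fun [set: R] f -> (forall x, (0 <= f x)%E) ->
  (\int[mu]_x f x = s%:E * \int[mu]_x f (s * x)%R)%E.
Proof.
move=> s0 mf f0.
pose phi : measurableTypeR R -> measurableTypeR R := fun x => s * x.
have mphi : measurable_fun [set: measurableTypeR R] phi by exact: measurable_funM.
pose k : {nonneg R} := NngNum (ltW s0).
have E A : measurable A -> mu A = mscale k (pushforward mu phi) A.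
  move=> mA; apply: lebesgue_measure_unique => //= _ [[a b]] _ <-.
  have P : phi @^-1` `]a, b]%classic = `]a / s, b / s]%classic.
    by apply/seteqP; split => x /=; rewrite !in_itv/= ltr_pdivrMr// ler_pdivlMr// mulrC.
  change (mu `]a, b]%classic = s%:E * mu (phi @^-1` `]a, b]%classic))%E.
  rewrite P.
  rewrite !lebesgue_measure_itv/= !lte_fin ltr_pM2r ?invr_gt0//.
  case: ifPn => _; last by rewrite mule0.
  by rewrite -!EFinB -EFinM; congr _%:E; field; rewrite gt_eqF.
rewrite [LHS](eq_measure_integral (mscale k (pushforward mu phi))); last first.
  by move=> A mA _; exact: E.
by rewrite ge0_integral_mscale//= ge0_integral_pushforward.
Qed.

(* [s] is the mass still to be distributed and [x] the next weight. *)
Definition cutpow (b s x : R) : R :=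
  if (0 < x) && (x < s) then (s - x) `^ (b - 1) else 0.

Lemma cutpow_ge0 (b s x : R) : 0 <= cutpow b s x.
Proof. by rewrite /cutpow; case: ifP => // _; exact: powR_ge0. Qed.

Lemma measurable_cutpow (b s : R) : measurable_fun [set: R] (cutpow b s).
Proof.
apply: measurable_fun_ifT => //=.
- by apply: measurable_and; apply: measurable_fun_ltr.
- apply: (measurableT_comp (measurable_powR (b - 1))).
  exact: measurable_funB.
Qed.

Lemma is_derive_powR_sub (c s x : R) : x < s ->
  is_derive x 1 (fun y : R => (s - y) `^ c) (- (c * (s - x) `^ (c - 1))).
Proof.
move=> xs; have sx0 : 0 < s - x by rewrite subr_gt0.
have H1 : is_derive x (1 : R) (cst s - id) (0 - 1) by exact: is_deriveB.
have H2 : is_derive ((cst s - id) x) (1 : R) (@powR R ^~ c) (c * (s - x) `^ (c - 1)).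
  exact: is_derive1_powR.
have H3 := is_derive1_comp H2 H1.
by apply: (is_derive_eq H3); rewrite sub0r mulrN1.
Qed.

(** For [b < 1] the integrand is unbounded near [s]. The fundamental theorem of calculus is applied
    on intervals that stop short of [s], and monotone convergence gives the limit. *)
Lemma integral_cutpow (b s : R) : 0 < b -> 0 < s ->
  (\int[mu]_x (cutpow b s x)%:E = (s `^ b / b)%:E)%E.
Proof.
move=> b0 s0.
pose f x : R := (s - x) `^ (b - 1).
pose F x : R := - ((s - x) `^ b / b).
have dF x : x < s -> is_derive x 1 F (f x).
  move=> xs.
  have -> : F = (- b^-1) \*: (fun y => (s - y) `^ b).
    by apply/funext => y; rewrite /F /= /GRing.scale/= mulNr mulrC.
  apply: is_derive_eq; first exact: is_deriveZ (is_derive_powR_sub b xs).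
  by rewrite /f /GRing.scale /=; field; lra.
(* With [n.+2] the interval is nondegenerate already for n = 0, as the fundamental theorem of
   calculus requires. *)
pose I (n : nat) := `[0, s - s / n.+2%:R]%classic.
have In (n : nat) : 0 < s - s / n.+2%:R :> R.
  by rewrite subr_gt0 ltr_pdivrMr// ltr_pMr// ltr1n.
have Is (n : nat) : s - s / n.+2%:R < s :> R.
  by rewrite ltrBlDr ltrDl divr_gt0.
have cf x : x < s -> {for x, continuous f}.
  move=> xs; apply/differentiable_continuous/derivable1_diffP.
  by case: (is_derive_powR_sub (b - 1) xs).
have E n : (\int[mu]_(x in I n) (f x)%:E = (F (s - s / n.+2%:R))%:E - (F 0)%:E)%E.
  apply: continuous_FTC2 => //.
  - apply: continuous_in_subspaceT => x /set_mem/=; rewrite in_itv/= => /andP[_ xn].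
    by apply: cf; exact: le_lt_trans xn (Is n).
  - split.
    + move=> x; rewrite in_itv/= => /andP[_ xn].
      by have [] := dF _ (lt_trans xn (Is n)).
    + apply: cvg_at_right_filter; apply/differentiable_continuous/derivable1_diffP.
      by have [] := dF _ s0.
    + apply: cvg_at_left_filter; apply/differentiable_continuous/derivable1_diffP.
      by have [] := dF _ (Is n).
  - move=> x; rewrite in_itv/= => /andP[_ xn]; rewrite derive1E.
    by have [_ ->] := dF _ (lt_trans xn (Is n)).
have UI : \bigcup_n I n = `[0, s[%classic.
  apply/seteqP; split => x.
    move=> [n _]; rewrite /I /= !in_itv/= => /andP[-> xn] /=.
    exact: le_lt_trans xn (Is n).
  rewrite /= in_itv/= => /andP[x0 xs].
  have [n Hn] : exists n : nat, s / (s - x) < n%:R.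
    exists (Num.trunc (s / (s - x))).+1; exact: Num.Theory.truncnS_gt.
  exists n => //; rewrite /I /= in_itv/= x0/=.
  rewrite lerBrDr -lerBrDl ler_pdivrMr//.
  move: Hn; rewrite ltr_pdivrMr ?subr_gt0// => /ltW/le_trans; apply.
  by rewrite mulrC ler_wpM2l ?subr_ge0 ?(ltW xs)// ler_nat; exact: leqW.
have mf : measurable_fun [set: R] f.
  apply: (measurableT_comp (@measurable_powR R (b - 1))).
  exact: measurable_funB.
have L1 : (\int[mu]_(x in I n) (f x)%:E)%E @[n --> \oo] --> (\int[mu]_(x in `[0%R, s[) (f x)%:E)%E.
  rewrite -UI; apply: ge0_nondecreasing_set_cvg_integral => //.
  - apply/nondecreasing_seqP => n; apply/subsetPset => x; rewrite /I /= !in_itv/= => /andP[-> xn]/=.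
    apply: le_trans xn _; rewrite lerD2l lerN2 ler_pM2l// lef_pV2 ?posrE// ler_nat//.
  - by move=> n; exact: measurable_itv.
  - by move=> n; exact/measurable_EFinP/measurable_funTS.
  - by move=> n x _; rewrite lee_fin powR_ge0.
have L2 : ((F (s - s / n.+2%:R))%:E - (F 0)%:E)%E @[n --> \oo] --> (s `^ b / b)%:E.
  rewrite (_ : (fun n : nat => ((F (s - s / n.+2%:R))%:E - (F 0)%:E)%E) =
    (fun n : nat => (s `^ b / b - ((s / n.+2%:R) `^ b / b))%:E)); last first.
    apply/funext => n; rewrite -EFinB; congr _%:E; rewrite /F subr0.
    by rewrite opprB addrCA subrr addr0; ring.
  apply: cvg_EFin; first by apply: nearW.
  rewrite -[X in _ --> X]subr0; apply: cvgB; first exact: cvg_cst.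
  rewrite -[X in _ --> X](mul0r b^-1); apply: cvgMr_tmp.
  have P := powR_cvg0 b0.
  apply: (cvg_comp (fun n : nat => s / n.+2%:R) _ _ P) => //.
  have C0 : s / n.+2%:R @[n --> \oo] --> (0 : R).
    rewrite -[X in _ --> X](mulr0 s); apply: cvgMl_tmp.
    by move: (@cvg_harmonic R); rewrite -cvg_shiftS.
  move=> A [e /= e0 HA].
  have H := (@cvgr0_norm_lt _ _ _ _ _ _ C0 _ e0).
  near=> n; apply: HA; last by rewrite divr_gt0.
  rewrite /= sub0r normrN; near: n; exact: H.
rewrite (funext E) in L1; have L3 := cvg_unique (@ereal_hausdorff R) L1 L2.
rewrite integral_itv_bndoo in L3; last exact/measurable_EFinP/measurable_funTS.
transitivity (\int[mu]_(x in `]0%R, s[) (f x)%:E)%E; last exact: L3.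
rewrite [RHS]integral_mkcond; apply: eq_integral => x _.
rewrite /patch /cutpow mem_setE in_itv/=.
by case: ifP.
Unshelve. all: by end_near. Qed.
End PowerIntegrals.

(** * Dirichlet moments by integrating out one weight at a time *)

Section DirichletMoments.
Set Implicit Arguments. Unset Strict Implicit. Unset Printing Implicit Defensive.
Context (R : realType).
Local Notation mu := (@lebesgue_measure R).

(** [complete 1] is [simplex_complete]. A general total [s] is needed because fixing a first weight
    [w] leaves mass [s - w] for the others. *)
Definition complete (s : R) (v : seq R) : seq R := rcons v (s - \sum_(u <- v) u).

Lemma complete_cons (s w : R) (v : seq R) : complete s (w :: v) = w :: complete (s - w) v.
Proof. by rewrite /complete rcons_cons big_cons opprD addrA. Qed.

Lemma size_complete (s : R) v : size (complete s v) = (size v).+1.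
Proof. by rewrite /complete size_rcons. Qed.

Lemma sum_complete s v : \sum_(u <- complete s v) u = s.
Proof. by rewrite /complete -cats1 big_cat/= big_seq1 addrC subrK. Qed.

Lemma dir_dens_cons (a : nat -> R) w l : dir_dens a (w :: l) =
  if 0 < w then w `^ (a 0%N - 1) * dir_dens (a \o S) l else 0.
Proof.
rewrite /dir_dens /=; case: ifPn => [/andP[-> ->]|]; first by rewrite big_ord_recl.
by case: (0 < w) => //= /negbTE ->; rewrite mulr0.
Qed.

Lemma dir_dens_ge0 (a : nat -> R) l : 0 <= dir_dens a l.
Proof.
by rewrite /dir_dens; case: ifP => // _; apply: prodr_ge0 => i _; exact: powR_ge0.
Qed.

Lemma powRD_gt0 (x r q : R) : 0 < x -> x `^ (r + q) = x `^ r * x `^ q.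
Proof. by move=> x0; rewrite powRD// (gt_eqF x0) implybT. Qed.

(** Unnormalised Beta density on (0, s): the profile of a first weight of parameter [a] when the
    remaining parameters add up to [b]. *)
Definition beta_dens (a b s x : R) : R := x `^ (a - 1) * cutpow b s x.

Lemma beta_dens_ge0 (a b s x : R) : 0 <= beta_dens a b s x.
Proof. by rewrite mulr_ge0 ?powR_ge0 ?cutpow_ge0. Qed.

Lemma measurable_beta_dens (a b s : R) : measurable_fun [set: R] (beta_dens a b s).
Proof.
by apply: measurable_funM; [exact: measurable_powR|exact: measurable_cutpow].
Qed.

(** The density is homogeneous of degree a + b - 2 in (s, x), and dx contributes one more power of
    [s]. *)
Lemma integral_beta_dens (a b s : R) : 0 < s ->
  (\int[mu]_x (beta_dens a b s x)%:E =
   (s `^ (a + b - 1))%:E * \int[mu]_x (beta_dens a b 1 x)%:E)%E.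
Proof.
move=> s0; rewrite (ge0_integral_scale s0); last 2 first.
- apply/measurable_EFinP. exact: measurable_beta_dens.
- by move=> x; rewrite lee_fin beta_dens_ge0.
have -> : s `^ (a + b - 1) = s * s `^ (a + b - 2).
  have -> : a + b - 1 = 1 + (a + b - 2) by ring.
  by rewrite (powRD_gt0 1 _ s0) (powRr1 (ltW s0)).
rewrite EFinM -muleA; congr (_ * _)%E.
rewrite -ge0_integralZl_EFin ?powR_ge0//; last 2 first.
- by move=> x _; rewrite lee_fin beta_dens_ge0.
- apply/measurable_EFinP; exact: measurable_beta_dens.
apply: eq_integral => x _; rewrite -EFinM /beta_dens /cutpow; congr _%:E.
rewrite pmulr_rgt0// gtr_pMr//; case: ifPn => [/andP[x0 x1]|_]; last by rewrite !mulr0.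
rewrite -{2}[s]mulr1 -mulrBr !powRM ?(ltW s0) ?(ltW x0) ?subr_ge0 ?(ltW x1)//.
have -> : s `^ (a + b - 2) = s `^ (a - 1) * s `^ (b - 1).
  by rewrite -powRD_gt0//; congr powR; ring.
by ring.
Qed.

Lemma integral_beta_dens1 (b : R) : 0 < b ->
  (\int[mu]_x (beta_dens 1 b 1 x)%:E = (b^-1)%:E)%E.
Proof.
move=> b0; under eq_integral do rewrite /beta_dens subrr powRr0 mul1r.
by rewrite integral_cutpow// powR1 mul1r.
Qed.

(** The guard encodes that the simplex of nonpositive mass is empty; [powR] alone does not vanish on
    negative bases. *)
Definition pospow (b s : R) : R := if 0 < s then s `^ (b - 1) else 0.

Lemma cutpowE (b s x : R) : cutpow b s x = if 0 < x then pospow b (s - x) else 0.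
Proof. by rewrite /cutpow /pospow subr_gt0; case: (0 < x). Qed.

(* A product of Beta integrals, left unevaluated. *)
Fixpoint dir_total (a : nat -> R) (t : nat) : \bar R :=
  if t is t'.+1 then
    (dir_total (a \o S) t' *
     \int[mu]_x (beta_dens (a 0%N) (\sum_(i < t) a i.+1)%R 1 x)%:E)%E
  else 1%E.

Lemma dir_total_ge0 a t : (0 <= dir_total a t)%E.
Proof.
elim: t a => //= t IH a; apply: mule_ge0; first exact: IH.
by apply: integral_ge0 => x _; rewrite lee_fin beta_dens_ge0.
Qed.

(* The density is homogeneous, so only the power of [s] matters. *)
Lemma dir_mass t (a : nat -> R) (p s : R) : 0 <= p ->
  (iter_int mu t (fun v => (p * dir_dens a (complete s v))%:E) =
   dir_total a t * (p * pospow (\sum_(i < t.+1) a i) s)%:E)%E.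
Proof.
elim: t a p s => [|t IH] a p s p0.
  rewrite /= /complete /= big_nil subr0 dir_dens_cons big_ord_recl big_ord0 addr0.
  rewrite mul1e /pospow; congr (_ * _)%:E; case: ifP => // _.
  by rewrite /dir_dens /= big_ord0 mulr1.
rewrite [LHS]/=.
(* The free factor [p] absorbs the power of the first weight, so the induction hypothesis applies at
   mass [s - w]. *)
have E w : iter_int mu t (fun v => (p * dir_dens a (complete s (w :: v)))%:E) =
   (dir_total (a \o S) t * (p * beta_dens (a 0%N) (\sum_(i < t.+1) a i.+1) s w)%:E)%E.
  under eq_iter_int => v _ do rewrite complete_cons dir_dens_cons.
  rewrite /beta_dens cutpowE; case: ifPn => w0.
    under eq_iter_int => v _ do rewrite mulrA.
    by rewrite IH ?mulr_ge0 ?powR_ge0// mulrA.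
  rewrite !mulr0 mule0.
  transitivity (iter_int mu t (fun v => (0 * dir_dens (a \o S) (complete 0 v))%:E)).
    by apply: eq_iter_int => v _; rewrite mul0r.
  by rewrite IH// mul0r mule0.
under eq_integral do rewrite E.
have [s0|s0] := ltP 0 s; last first.
  rewrite [pospow _ s]/pospow ltNge s0/= mulr0 mule0.
  apply: integral0_eq => x _; rewrite /beta_dens /cutpow.
  case: ifPn => [/andP[x0 xs]|_]; last by rewrite !mulr0 mule0.
  by have := lt_trans x0 xs; rewrite ltNge s0.
rewrite ge0_integralZl//; last 3 first.
- apply/measurable_EFinP; apply: measurable_funM => //; exact: measurable_beta_dens.
- by move=> x _; rewrite lee_fin mulr_ge0// beta_dens_ge0.
- exact: dir_total_ge0.
under eq_integral do rewrite EFinM.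
rewrite ge0_integralZl_EFin//; last 2 first.
- by move=> x _; rewrite lee_fin beta_dens_ge0.
- apply/measurable_EFinP; exact: measurable_beta_dens.
rewrite integral_beta_dens// /pospow s0 (big_ord_recl t.+1)/= EFinM -!muleA.
congr (_ * _)%E; rewrite muleCA muleA [RHS]muleC.
by congr (_ * _)%E; rewrite muleC.
Qed.

End DirichletMoments.

(** * Second moments when the data weights have parameter 1 *)

Section MixedDirichlet.
Set Implicit Arguments. Unset Strict Implicit. Unset Printing Implicit Defensive.
Context (R : realType).
Local Notation mu := (@lebesgue_measure R).

Definition mixed_param (b : R) (n i : nat) : R := if (i < n)%N then 1 else b.

Lemma sum_mixed_param (b : R) (n t : nat) :
  \sum_(i < (n + t).+1) mixed_param b n i = t.+1%:R * b + n%:R.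
Proof.
elim: n => [|n IH].
  by rewrite add0n addr0 (eq_bigr (fun=> b))// sumr_const card_ord mulr_natl.
rewrite addSn big_ord_recl [X in _ + X](_ : _ = \sum_(i < (n + t).+1) mixed_param b n i)//.
by rewrite IH /mixed_param /= -[in RHS]natr1; ring.
Qed.

(** This is $\Gamma(al)/\Gamma(al+n)$, the share of [n] weights of parameter 1 in the normalising
    constant. *)
Definition rising_inv (al : R) (n : nat) : R := \prod_(i < n) (al + i%:R)^-1.

Lemma rising_inv_gt0 (al : R) n : 0 < al -> 0 < rising_inv al n.
Proof.
by move=> al0; apply: prodr_gt0 => i _; rewrite invr_gt0 ltr_pwDl.
Qed.

(** A weight of parameter 1 put in front of parameters of total B contributes the Beta value 1 / B,
    where B grows by 1 with each such weight. *)
Lemma dir_total_mixed (b : R) (n t : nat) : 0 < b ->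
  dir_total (mixed_param b n) (n + t) =
  (dir_total (fun=> b) t * (rising_inv (t.+1%:R * b) n)%:E)%E.
Proof.
move=> b0; elim: n => [|n IH].
  by rewrite /rising_inv big_ord0 mule1 add0n.
rewrite addSn [LHS]/= [X in (dir_total X _ * _)%E](_ : _ = mixed_param b n)// IH.
rewrite (_ : \sum_(i < (n + t).+1) mixed_param b n.+1 i.+1 =
  \sum_(i < (n + t).+1) mixed_param b n i)// sum_mixed_param.
rewrite [mixed_param b n.+1 0]/mixed_param /= integral_beta_dens1 ?ltr_pwDl ?mulr_gt0//.
by rewrite -muleA -EFinM /rising_inv big_ord_recr.
Qed.

Lemma iter_intN n (f : seq R -> \bar R) : (forall s, (0 <= f s)%E) ->
  iter_int mu n (fun s => - f s)%E = (- iter_int mu n f)%E.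
Proof.
elim: n f => //= n IH f f0; under eq_integral do rewrite IH//.
by rewrite integral_ge0N// => x _; apply: iter_int_ge0.
Qed.

(** In the moment computation [p] is built from kernel values and can be negative; that case is
    reduced to [- p]. *)
Lemma dir_mass_fin t (a : nat -> R) (c p s : R) : dir_total a t = c%:E ->
  iter_int mu t (fun v => (p * dir_dens a (complete s v))%:E) =
  (c * (p * pospow (\sum_(i < t.+1) a i) s))%:E.
Proof.
move=> ac; have [p0|p0] := leP 0 p; first by rewrite dir_mass// ac.
transitivity (iter_int mu t (fun v => - (- p * dir_dens a (complete s v))%:E)%E).
  by apply: eq_iter_int => v _; rewrite -EFinN mulNr opprK.
rewrite iter_intN => [|v]; last by rewrite lee_fin mulr_ge0 ?oppr_ge0 ?(ltW p0) ?dir_dens_ge0.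
by rewrite dir_mass ?oppr_ge0 ?(ltW p0)// ac -EFinM -EFinN; congr _%:E; ring.
Qed.

Lemma integrable_cutpow (b s : R) : 0 < b -> 0 < s ->
  mu.-integrable setT (EFin \o cutpow b s).
Proof.
move=> b0 s0; apply/integrableP; split.
  apply/measurable_EFinP; exact: measurable_cutpow.
under eq_integral do rewrite /= ger0_norm ?cutpow_ge0//.
by rewrite integral_cutpow// ltry.
Qed.

(** This is the one-dimensional integral of each inductive step on the moments: a quadratic
    polynomial in s - x times a power of s - x. The coefficients are signed, hence the detour
    through integrability. *)
Lemma integral_cutpow3 (A s k0 k1 k2 : R) : 0 < A -> 0 < s ->
  (\int[mu]_x (k0 * cutpow A s x + k1 * cutpow (A + 1) s x
     + k2 * cutpow (A + 2) s x)%:E =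
  (s `^ A * (k0 / A + k1 * s / (A + 1) + k2 * s ^+ 2 / (A + 2)))%:E)%E.
Proof.
move=> A0 s0.
have A1 : 0 < A + 1 by exact: addr_gt0.
have A2 : 0 < A + 2 by exact: addr_gt0.
have I k b : 0 < b -> mu.-integrable setT (fun x => (k * cutpow b s x)%:E).
  by move=> b0; have := @integrableZl _ _ _ mu _ measurableT k _ (integrable_cutpow b0 s0).
have V k b : 0 < b -> (\int[mu]_x (k * cutpow b s x)%:E = (k * (s `^ b / b))%:E)%E.
  move=> b0; under eq_integral do rewrite EFinM.
  by rewrite integralZl//= ?integral_cutpow//; exact: integrable_cutpow.
under eq_integral do rewrite EFinD.
rewrite integralD//=; [|exact: (integrableD _ (I _ _ A0) (I _ _ A1))|exact: I].
under eq_integral do rewrite EFinD.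
rewrite integralD//=; [|exact: I|exact: I].
rewrite !V// -!EFinD (powRD_gt0 A 1 s0) (powRD_gt0 A 2 s0) (powRr1 (ltW s0)).
rewrite (powR_mulrn 2 (ltW s0)).
by congr _%:E; field; rewrite !gt_eqF.
Qed.

Context (X : Type) (kt : X -> X -> R) (ktC : forall x y, kt x y = kt y x).

Definition quad (W : seq (R * X)) : R :=
  \sum_(p <- W) \sum_(q <- W) p.1 * q.1 * kt p.2 q.2.

(** The diagonal counts twice because weights of parameter 1 have second moments proportional to
    $1+\delta_{ij}$. *)
Definition gram2 (xs : seq X) : R :=
  \sum_(x <- xs) \sum_(y <- xs) kt x y + \sum_(x <- xs) kt x x.

Lemma quad_cons w x W : quad ((w, x) :: W) =
  w ^+ 2 * kt x x + (\sum_(p <- W) p.1 * (2 * w * kt x p.2)) + quad W.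
Proof.
rewrite /quad big_cons/= big_cons/=.
under [X in _ + X = _]eq_bigr do rewrite big_cons/=.
rewrite big_split/= addrA; congr (_ + _).
rewrite -addrA -big_split/= expr2; congr (_ + _).
by apply: eq_bigr => p _; rewrite (ktC p.2); ring.
Qed.

Lemma gram2_cons x xs : gram2 (x :: xs) =
  2 * kt x x + 2 * \sum_(y <- xs) kt x y + gram2 xs.
Proof.
rewrite /gram2 !big_cons; under [X in _ + X + _]eq_bigr do rewrite big_cons.
rewrite big_split/=.
have -> : \sum_(y <- xs) kt y x = \sum_(y <- xs) kt x y by apply: eq_bigr.
by ring.
Qed.

(** The integrand is chosen to be stable under fixing the first weight [w] at the point [x]: the
    cross terms join the linear part as [2 * w * kt x], the square joins [c0], and the mass drops to
    [s - w]. In the result, the factors before the bracket are the total mass and the bracket is the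
    mean: $s^2/(A(A+1))$ scales the second moments, $s/A$ is the mean of a data weight, and
    $s\,al/A$ that of the auxiliary mass. The last weight, fixed by the others, is always
    auxiliary. *)
Lemma dirichlet_moments (b c : R) (t : nat) (rho : R) (al := t.+1%:R * b) :
  0 < b -> dir_total (fun=> b) t = c%:E ->
  forall (xs : seq X) (f : X -> R) (c0 s : R) (A := al + (size xs)%:R),
  iter_int mu (size xs + t) (fun v =>
    ((quad (zip (complete s v) xs) + \sum_(p <- zip (complete s v) xs) p.1 * f p.2
      + c0 + rho * \sum_(u <- drop (size xs) (complete s v)) u)
     * dir_dens (mixed_param b (size xs)) (complete s v))%:E) =
  (c * (rising_inv al (size xs) * (pospow A s *
     (s ^+ 2 / (A * (A + 1)) * gram2 xs + s / A * (\sum_(x <- xs) f x)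
      + c0 + rho * s * al / A))))%:E.
Proof.
move=> b0 cE; have al0 : 0 < al by rewrite mulr_gt0.
elim=> [|x xs IH] f c0 s A.
  rewrite [size _]/= add0n.
  under eq_iter_int => v _.
    have -> : zip (complete s v) [::] = [::] :> seq (R * X) by case: (complete s v).
    rewrite /quad !big_nil drop0 sum_complete !add0r.
    over.
  rewrite (dir_mass_fin _ _ cE) sumr_const card_ord /A /= /rising_inv big_ord0.
  rewrite /gram2 !big_nil addr0 -(mulr_natl b) -/al.
  congr _%:E; field. by rewrite !gt_eqF ?addr_gt0.
rewrite [size _]/= addSn [LHS]/=.
set B := al + (size xs)%:R in IH.
have B0 : 0 < B by rewrite ltr_pwDl.
have AE : A = B + 1 by rewrite /A /B /= -natr1 addrA.
pose Sf := \sum_(y <- xs) f y.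
pose K := \sum_(y <- xs) kt x y.
(* Coefficients of the value given by the induction hypothesis, expanded in powers of u = s - w
   after substituting w = s - u; each power of u raises the parameter of [cutpow] by 1. *)
pose k0 := c0 + f x * s + s ^+ 2 * kt x x.
pose k1 := Sf / B + 2 * s * K / B - f x - 2 * s * kt x x + rho * al / B.
pose k2 := gram2 xs / (B * (B + 1)) - 2 * K / B + kt x x.
pose g := c * rising_inv al (size xs).
transitivity (\int[mu]_w ((g * k0) * cutpow B s w + (g * k1) * cutpow (B + 1) s w
     + (g * k2) * cutpow (B + 2) s w)%:E)%E.
  apply: eq_integral => w _.
  have [w0|w0] := ltP 0 w; last first.
    have cp0 e : cutpow e s w = 0 by rewrite cutpowE ltNge w0.
    rewrite !cp0 !mulr0 !addr0.
    transitivity (iter_int mu (size xs + t) (fun v => (0 * dir_dens (fun=> b) (complete s v))%:E)).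
      apply: eq_iter_int => v _.
      by rewrite complete_cons dir_dens_cons ltNge w0/= mulr0 mul0r.
    rewrite dir_mass// mul0r mule0//.
  have -> : iter_int mu (size xs + t) (fun v =>
    ((quad (zip (complete s (w :: v)) (x :: xs)) +
      \sum_(p <- zip (complete s (w :: v)) (x :: xs)) p.1 * f p.2
      + c0 + rho * \sum_(u <- drop (size xs).+1 (complete s (w :: v))) u)
     * dir_dens (mixed_param b (size xs).+1) (complete s (w :: v)))%:E) =
   iter_int mu (size xs + t) (fun v =>
    ((quad (zip (complete (s - w) v) xs) +
      \sum_(p <- zip (complete (s - w) v) xs) p.1 * (f p.2 + 2 * w * kt x p.2)
      + (c0 + f x * w + w ^+ 2 * kt x x)
      + rho * \sum_(u <- drop (size xs) (complete (s - w) v)) u)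
     * dir_dens (mixed_param b (size xs)) (complete (s - w) v))%:E).
    apply: eq_iter_int => v _; rewrite complete_cons dir_dens_cons w0.
    rewrite [mixed_param _ _ 0]/= subrr powRr0 mul1r [zip _ _]/= quad_cons big_cons/=.
    congr (_ * _)%:E.
    under [in RHS]eq_bigr do rewrite mulrDr.
    by rewrite big_split/=; ring.
  apply: etrans (IH (fun y => f y + 2 * w * kt x y) _ (s - w)) _.
  rewrite big_split/= -mulr_sumr -/Sf -/K !cutpowE w0 /pospow.
  congr _%:E; rewrite subr_gt0; case: ifPn => ws; last by rewrite !(mul0r, mulr0, addr0).
  have sw0 : 0 < s - w by rewrite subr_gt0.
  have -> : B + 1 - 1 = B - 1 + 1 by ring.
  have -> : B + 2 - 1 = B - 1 + 2 by ring.
  rewrite (powRD_gt0 (B - 1) 1 sw0) (powRD_gt0 (B - 1) 2 sw0) (powRr1 (ltW sw0)).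
  rewrite (powR_mulrn 2 (ltW sw0)).
  rewrite /g /k0 /k1 /k2.
  by have B1 : 0 < B + 1 := addr_gt0 B0 ltr01; field; rewrite (gt_eqF B0) (gt_eqF B1).
have [s0|s0] := ltP 0 s; last first.
  rewrite /pospow ltNge s0/= mul0r !mulr0.
  apply: integral0_eq => w _; have cp0 e : cutpow e s w = 0.
    rewrite /cutpow; case: ifPn => // /andP[w0 ws].
    by have := lt_trans w0 ws; rewrite ltNge s0.
  by rewrite !cp0 !mulr0 !addr0.
rewrite integral_cutpow3// /pospow s0 gram2_cons big_cons AE.
have -> : rising_inv al (size xs).+1 = rising_inv al (size xs) / B.
  by rewrite /rising_inv big_ord_recr.
rewrite addrK /g /k0 /k1 /k2 -/Sf -/K; congr _%:E.
have B1 : 0 < B + 1 by exact: addr_gt0.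
have B2 : 0 < B + 2 by exact: addr_gt0.
have B11 : 0 < B + 1 + 1 by exact: addr_gt0.
by field; rewrite !gt_eqF.
Qed.

End MixedDirichlet.

(** * Kernel mean embeddings without the RKHS *)

Section BoundedMeasurable.
Set Implicit Arguments. Unset Strict Implicit. Unset Printing Implicit Defensive.
Context (R : realType) (d : measure_display) (X : measurableType d).

(** A class integrable against every probability measure at once and stable under linear
    combinations. *)
Definition bounded_measurable (f : X -> R) : Prop :=
  measurable_fun [set: X] f /\ exists M, forall x, `|f x| <= M.

Lemma bmf_cst (c : R) : bounded_measurable (fun=> c).
Proof. by split=> //; exists `|c|. Qed.

Lemma bmfD (f g : X -> R) : bounded_measurable f -> bounded_measurable g -> bounded_measurable (fun x => f x + g x).
Proof.
move=> [mf [M fM]] [mg [N gN]]; split; first exact: measurable_funD.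
by exists (M + N) => x; rewrite (le_trans (ler_normD _ _))// lerD.
Qed.

Lemma bmfZ (c : R) (f : X -> R) : bounded_measurable f -> bounded_measurable (fun x => c * f x).
Proof.
move=> [mf [M fM]]; split; first exact: measurable_funM.
by exists (`|c| * M) => x; rewrite normrM ler_wpM2l.
Qed.

Lemma bmf_sum (I : Type) (s : seq I) (F : I -> X -> R) :
  (forall i, bounded_measurable (F i)) -> bounded_measurable (fun x => \sum_(i <- s) F i x).
Proof.
move=> bF; elim: s => [|i s IH].
  by under eq_fun do rewrite big_nil; exact: bmf_cst.
by under eq_fun do rewrite big_cons; exact: bmfD.
Qed.

Lemma bmf_integrable (P : probability X R) (f : X -> R) : bounded_measurable f ->
  P.-integrable setT (EFin \o f).
Proof.
move=> [mf [M fM]]; apply: measurable_bounded_integrable => //.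
  by apply: (le_lt_trans (probability_le1 P measurableT)); exact: ltry.
exists M; split; first exact: num_real.
by move=> N MN x _; exact: le_trans (fM x) (ltW MN).
Qed.

Lemma bmf_integral (P : probability X R) (f : X -> R) : bounded_measurable f ->
  (\int[P]_x (f x)%:E)%E = (\int[P]_x f x)%:E.
Proof.
move=> bf; rewrite /Rintegral fineK//.
exact: integrable_fin_num (bmf_integrable P bf).
Qed.

Lemma expectD (P : probability X R) (f g : X -> R) : bounded_measurable f -> bounded_measurable g ->
  \int[P]_x (f x + g x) = \int[P]_x f x + \int[P]_x g x.
Proof. by move=> bf bg; rewrite RintegralD//; exact: bmf_integrable. Qed.

Lemma expectZ (P : probability X R) c (f : X -> R) : bounded_measurable f ->
  \int[P]_x (c * f x) = c * \int[P]_x f x.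
Proof. by move=> bf; rewrite RintegralZl//; exact: bmf_integrable. Qed.

Lemma expect_cst (P : probability X R) c : \int[P]_x c = c.
Proof.
rewrite Rintegral_cst// -[RHS]mulr1; congr (_ * _).
exact: (congr1 fine (probability_setT P)).
Qed.

Lemma expect_sum (P : probability X R) (I : Type) (s : seq I) (F : I -> X -> R) :
  (forall i, bounded_measurable (F i)) ->
  \int[P]_x (\sum_(i <- s) F i x) = \sum_(i <- s) \int[P]_x F i x.
Proof.
move=> bF; elim: s => [|i s IH].
  by under eq_Rintegral do rewrite big_nil; rewrite expect_cst big_nil.
under eq_Rintegral do rewrite big_cons.
by rewrite expectD ?IH ?big_cons//; exact: bmf_sum.
Qed.

Lemma expect_norm_le (P : probability X R) (f : X -> R) M : bounded_measurable f ->
  (forall x, `|f x| <= M) -> `|\int[P]_x f x| <= M.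
Proof.
move=> bf fM; rewrite (le_trans (le_normr_Rintegral _ (bmf_integrable P bf)))//.
rewrite -[leRHS](expect_cst P); apply: le_Rintegral => //.
- apply: (@bmf_integrable P (fun x => `|f x|)); split; last first.
    by exists M => x; rewrite normr_id.
  by case: bf => mf _; exact: measurableT_comp.
- exact: (bmf_integrable P (bmf_cst M)).
Qed.

Lemma wdirac_integral (f : X -> R) (t : seq (R * X)) :
  measurable_fun [set: X] f -> (forall p, p \in map fst t -> 0 <= p) ->
  (wdirac t).-integrable setT (EFin \o f) /\
  (\int[wdirac t]_x (f x)%:E)%E = (\sum_(p <- t) p.1 * f p.2)%:E.
Proof.
move=> mf; have mF : measurable_fun [set: X] (EFin \o f) by exact/measurable_EFinP.
elim: t => [_|[w x] t IH t0] /=.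
  rewrite big_nil integral_measure_zero; split => //.
  by apply/integrableP; split => //; rewrite integral_measure_zero.
have w0 : 0 <= w by apply: t0; rewrite inE eqxx.
have [|I1 I2] := IH; first by move=> p pt; apply: t0; rewrite inE pt orbT.
have nw : (nnpart w)%:num = w by rewrite /= max_l.
have G (g : X -> \bar R) : measurable_fun setT g -> (forall x, (0 <= g x)%E) ->
    (\int[mscale (nnpart w) (\d_x)]_y g y = w%:E * g x)%E.
  by move=> mg g0; rewrite ge0_integral_mscale// integral_dirac// diracT mul1e nw.
have J1 : (mscale (nnpart w) (\d_x)).-integrable setT (EFin \o f).
  apply/integrableP; split => //; rewrite G//; last exact: measurableT_comp.
  by rewrite -EFinM ltry.
have J2 : (\int[mscale (nnpart w) (\d_x)]_y (f y)%:E = (w * f x)%:E)%E.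
  rewrite integralE !G//; [|exact: measurable_funeneg|exact: measurable_funepos].
  rewrite funeposE funenegE /= -!EFin_max -!EFinM -EFinN -EFinD; congr _%:E.
  rewrite -mulrBr; congr (_ * _); have [f0|f0] := leP 0 (f x).
    by rewrite max_r ?subr0// oppr_le0.
  by rewrite max_l ?opprK ?add0r// oppr_ge0 ltW.
split.
  apply/integrableP; split => //.
  rewrite ge0_integral_measure_add//; last exact: measurableT_comp.
  by move: I1 J1 => /integrableP[_ i1] /integrableP[_ j1]; exact: lte_add_pinfty.
by rewrite integral_measure_add// I2 J2 -EFinD big_cons.
Qed.

(** Integrating the constant 1 shows that the total mass is 1, so the normalisation divides by 1 and
    the fallback [Q] is not taken. *)
Lemma wdirac_prob_integral (Q : probability X R) (f : X -> R) (t : seq (R * X)) :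
  measurable_fun [set: X] f -> (forall p, p \in map fst t -> 0 <= p) ->
  \sum_(p <- t) p.1 = 1 ->
  \int[wdirac_prob Q t]_x f x = \sum_(p <- t) p.1 * f p.2.
Proof.
move=> mf t0 t1.
have T1 : wdirac t setT = 1%E.
  have [_] := @wdirac_integral (fun=> 1) t (measurable_cst _) t0.
  rewrite integral_cst// mul1e => ->.
  by under eq_bigr do rewrite mulr1; rewrite t1.
have [_ E] := wdirac_integral mf t0.
rewrite -[RHS]/(fine (_%:E)) -E /Rintegral; congr fine.
apply: eq_measure_integral => A mA _.
by rewrite /wdirac_prob /= /mnormalize T1 onee_eq0/= invr1 mule1.
Qed.

End BoundedMeasurable.

(** * Positive semidefiniteness, from points to measures *)

Section Kernel.
Set Implicit Arguments. Unset Strict Implicit. Unset Printing Implicit Defensive.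
Context (R : realType) (d : measure_display) (X : measurableType d).
Context (k : X -> X -> R)
  (hk_meas : measurable_fun [set: X * X] (fun p : X * X => k p.1 p.2))
  (hk_rep : reproducing_kernel k) (hk_bd : forall x y, `|k x y| <= 1).

Let kC x y : k x y = k y x. Proof. by have [] := hk_rep. Qed.

Definition kmean (Q : probability X R) (x : X) : R := \int[Q]_y k x y.

Lemma bmf_kernel x : bounded_measurable (k x).
Proof.
split; last by exists 1.
exact: (measurable_fun_pair2 x hk_meas).
Qed.

Lemma bmf_kernel_diag : bounded_measurable (fun x => k x x).
Proof.
split; last by exists 1.
exact: (measurableT_comp hk_meas (measurable_fun_pair (@measurable_id _ _ _) (@measurable_id _ _ _))).
Qed.

Lemma kernel_prod_integrable (P Q : probability X R) :
  (P \x Q)%E.-integrable setT (EFin \o (fun p : X * X => k p.1 p.2)).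
Proof.
apply/integrable12ltyP; first exact/measurable_EFinP.
apply: (@le_lt_trans _ _ (\int[P]_x \int[Q]_y 1)%E); last first.
  rewrite (bmf_integral Q (bmf_cst X 1)) expect_cst.
  by rewrite (bmf_integral P (bmf_cst X 1)) ltry.
apply: ge0_le_integral_nomeas => x; first exact: integral_ge0.
by apply: ge0_le_integral_nomeas => // y; rewrite lee_fin.
Qed.

Lemma bmf_kmean (Q : probability X R) : bounded_measurable (kmean Q).
Proof.
split.
  have := measurable_fubini_F (kernel_prod_integrable Q Q).
  rewrite /fubini_F => m; apply/measurable_EFinP; move: m.
  congr measurable_fun; apply/funext => x.
  by rewrite /= -bmf_integral//; exact: bmf_kernel.
by exists 1 => x; apply: expect_norm_le => //; exact: bmf_kernel.
Qed.

Lemma kintE (P Q : probability X R) : kint k P Q = \int[P]_x kmean Q x.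
Proof.
rewrite /kint /Rintegral; congr fine; apply: eq_integral => x _.
by rewrite bmf_integral//; exact: bmf_kernel.
Qed.

Lemma kintC (P Q : probability X R) : kint k P Q = kint k Q P.
Proof.
rewrite /kint; congr fine.
rewrite (Fubini (kernel_prod_integrable P Q))/=.
by apply: eq_integral => x _; apply: eq_integral => y _; rewrite kC.
Qed.

Let psd_points (t : seq (R * X)) : 0 <= quad k t.
Proof.
have [_ H] := hk_rep.
have [->|/eqP t0] := eqVneq t [::] => [|]; first by rewrite /quad big_nil.
case: t t0 => // p0 t' _; set t := p0 :: t'.
have := H (size t) (fun i => (nth p0 t i).2) (fun i => (nth p0 t i).1).
rewrite /quad (big_nth p0) big_mkord.
by under [in X in _ -> X]eq_bigr do rewrite (big_nth p0) big_mkord.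
Qed.

Definition pairing (t : seq (R * X)) (s : seq (R * probability X R)) : R :=
  \sum_(q <- s) q.1 * \sum_(p <- t) p.1 * kmean q.2 p.2.

(** Each bracket is the variance $E\|k(x,\cdot)-\mu_P\|^2$ of the embedding of one draw x from P. *)
Definition diag_excess (s : seq (R * probability X R)) : R :=
  \sum_(q <- s) q.1 ^+ 2 * (\int[q.2]_x k x x - kint k q.2 q.2).

(* Averaging the positive semidefinite form over an independent draw from each measure
   in [s]: the two copies of one draw coincide, whence the diagonal correction. *)
Lemma psd_sampled (s : seq (R * probability X R)) (t : seq (R * X)) :
  0 <= quad k t + 2 * pairing t s + quad (kint k) s + diag_excess s.
Proof.
elim: s t => [|[c P] s IH] t.
  by rewrite /pairing /diag_excess {2}/quad !big_nil mulr0 !addr0.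
pose L x := \sum_(q <- s) q.1 * (c * kmean q.2 x).
pose K x := \sum_(p <- t) p.1 * (2 * c * k p.2 x).
have bL : bounded_measurable L by apply: bmf_sum => q; do 2 apply: bmfZ; exact: bmf_kmean.
have bK : bounded_measurable K by apply: bmf_sum => q; do 2 apply: bmfZ; exact: bmf_kernel.
(* The induction hypothesis for [t] extended by the point [x] with coefficient [c], sorted by its
   dependence on [x] for termwise integration. *)
pose g x := c ^+ 2 * k x x + (K x + (2 * L x +
  (quad k t + 2 * pairing t s + quad (kint k) s + diag_excess s))).
have g0 x : 0 <= g x.
  have PE : pairing ((c, x) :: t) s = L x + pairing t s.
    rewrite /pairing /L -big_split; apply: eq_bigr => q _ /=.
    by rewrite big_cons mulrDr.
  have := IH ((c, x) :: t); congr (_ <= _); rewrite (quad_cons kC) PE /g.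
  have -> : \sum_(p <- t) p.1 * (2 * c * k x p.2) = K x.
    by apply: eq_bigr => p _; rewrite kC.
  by ring.
have := @Rintegral_ge0 _ _ _ P setT g (fun x _ => g0 x).
have bD := bmfZ (c ^+ 2) bmf_kernel_diag.
have bC := bmf_cst X (quad k t + 2 * pairing t s + quad (kint k) s + diag_excess s).
have b2 := bmfZ 2 bL.
rewrite /g expectD//; last by do 2 apply: bmfD => //.
rewrite expectD//; last exact: bmfD.
rewrite expectD// expect_cst !expectZ//; last exact: bmf_kernel_diag.
have -> : \int[P]_x K x = 2 * (c * \sum_(p <- t) p.1 * kmean P p.2).
  rewrite expect_sum => [|p]; last by do 2 apply: bmfZ; exact: bmf_kernel.
  rewrite mulrA mulr_sumr; apply: eq_bigr => p _.
  rewrite expectZ ?expectZ//; [|exact: bmf_kernel|apply: bmfZ; exact: bmf_kernel].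
  by rewrite -/(kmean P p.2); ring.
have -> : 2 * \int[P]_x L x = \sum_(q <- s) q.1 * (2 * c * kint k P q.2).
  rewrite expect_sum => [|p]; last by do 2 apply: bmfZ; exact: bmf_kmean.
  rewrite mulr_sumr; apply: eq_bigr => q _.
  rewrite expectZ ?expectZ//; [|exact: bmf_kmean|apply: bmfZ; exact: bmf_kmean].
  by rewrite -kintE; ring.
congr (_ <= _); rewrite (quad_cons kintC) /pairing /diag_excess !big_cons/=.
by ring.
Qed.

Lemma sum_copies (A : Type) (N : nat) (l : seq A) (F : A -> R) :
  \sum_(q <- flatten (nseq N l)) F q = N%:R * \sum_(q <- l) F q.
Proof.
elim: N => [|N IH] /=; first by rewrite big_nil mul0r.
by rewrite big_cat/= IH -natr1; ring.
Qed.

(** Splitting each measure into N + 1 copies with coefficients divided by N + 1 changes neither the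
    pairing nor the quadratic part, but divides the diagonal correction by N + 1. A negative value
    would be exposed by a large N. *)
Lemma psd_mixed (s : seq (R * probability X R)) (t : seq (R * X)) :
  0 <= quad k t + 2 * pairing t s + quad (kint k) s.
Proof.
set A := (X in 0 <= X); rewrite leNgt; apply/negP => A0.
have H (N : nat) : 0 <= A + diag_excess s / N.+1%:R.
  have n0 : N.+1%:R != 0 :> R by rewrite pnatr_eq0.
  pose sN := flatten (nseq N.+1 [seq (q.1 / N.+1%:R, q.2) | q <- s]).
  have E1 : pairing t sN = pairing t s.
    rewrite /pairing sum_copies big_map mulr_sumr; apply: eq_bigr => q _ /=.
    by field.
  have E2 : quad (kint k) sN = quad (kint k) s.
    rewrite /quad sum_copies big_map mulr_sumr; apply: eq_bigr => q _ /=.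
    rewrite sum_copies big_map mulrA !mulr_sumr; apply: eq_bigr => r _ /=.
    by field.
  have E3 : diag_excess sN = diag_excess s / N.+1%:R.
    rewrite /diag_excess sum_copies big_map mulr_sumr mulr_suml.
    by apply: eq_bigr => q _ /=; field.
  by have := psd_sampled sN t; rewrite E1 E2 E3.
have [N HN] : exists N : nat, diag_excess s / (- A) < N.+1%:R.
  by exists (Num.trunc (diag_excess s / (- A))); exact: Num.Theory.truncnS_gt.
have := H N; apply/negP; rewrite -ltNge.
rewrite -ltrBrDl sub0r ltr_pdivrMr// mulrC -ltr_pdivrMr// oppr_gt0//.
Qed.
End Kernel.

(** * The MMD pseudometric and the centred kernel *)

Section MMDTheory.
Set Implicit Arguments. Unset Strict Implicit. Unset Printing Implicit Defensive.
Context (R : realType) (d : measure_display) (X : measurableType d).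
Context (k : X -> X -> R)
  (hk_meas : measurable_fun [set: X * X] (fun p : X * X => k p.1 p.2))
  (hk_rep : reproducing_kernel k) (hk_bd : forall x y, `|k x y| <= 1).

Let kC x y : k x y = k y x. Proof. by have [] := hk_rep. Qed.
Let kiC := kintC hk_meas hk_rep hk_bd.

(** The discriminant argument, with explicit test vectors. If both roots are positive, $(\sqrt
    V,-\sqrt U)$ makes the form negative as soon as c exceeds their product. *)
Lemma quad_form_cauchy_schwarz (U V c : R) :
  (forall a b, 0 <= a ^+ 2 * U + 2 * a * b * c + b ^+ 2 * V) ->
  [/\ 0 <= U, 0 <= V & c <= Num.sqrt U * Num.sqrt V].
Proof.
move=> H.
have U0 : 0 <= U by have := H 1 0; congr (_ <= _); ring.
have V0 : 0 <= V by have := H 0 1; congr (_ <= _); ring.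
split => //; rewrite leNgt; apply/negP => cUV.
set x := Num.sqrt U in cUV; set y := Num.sqrt V in cUV.
have x0 : 0 <= x := sqrtr_ge0 _.
have y0 : 0 <= y := sqrtr_ge0 _.
have Ux : U = x ^+ 2 by rewrite sqr_sqrtr.
have Vy : V = y ^+ 2 by rewrite sqr_sqrtr.
have c0 : 0 < c by apply: le_lt_trans cUV; exact: mulr_ge0.
have [xy0|xy0] := ltP 0 (x * y).
  have := H y (- x); rewrite Ux Vy.
  have -> : y ^+ 2 * x ^+ 2 + 2 * y * - x * c + (- x) ^+ 2 * y ^+ 2 =
    2 * (x * y) * (x * y - c) by ring.
  have xy2 : 0 < 2 * (x * y) by apply: mulr_gt0.
  by rewrite (pmulr_rge0 _ xy2) subr_ge0 leNgt cUV.
have /eqP : x * y = 0 by apply/eqP; rewrite eq_le xy0 mulr_ge0.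
rewrite mulf_eq0 => /orP[|] /eqP z0.
(* With U = 0 the form is affine in its first argument, and this argument is the one that gives the
   value -1. *)
- have := H (- ((V + 1) / (2 * c))) 1; rewrite Ux z0.
  have -> : (- ((V + 1) / (2 * c))) ^+ 2 * 0 ^+ 2 +
     2 * - ((V + 1) / (2 * c)) * 1 * c + 1 ^+ 2 * V = -1.
    by field; rewrite gt_eqF.
  by rewrite ler0N1.
- have := H 1 (- ((U + 1) / (2 * c))); rewrite Vy z0.
  have -> : 1 ^+ 2 * U + 2 * 1 * - ((U + 1) / (2 * c)) * c +
     (- ((U + 1) / (2 * c))) ^+ 2 * 0 ^+ 2 = -1.
    by field; rewrite gt_eqF.
  by rewrite ler0N1.
Qed.

Lemma MMD2C (P Q : probability X R) : MMD2 k P Q = MMD2 k Q P.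
Proof. by rewrite /MMD2 (kiC P Q); ring. Qed.

(** This is $\|a(\mu_P-\mu_Q)+b(\mu_Q-\mu_S)\|^2$, that is, coefficients a, b - a and -b on the
    three embeddings. Its cross term is the one that the triangle inequality has to bound. *)
Let mmd_form (P Q S : probability X R) (a b : R) :
  0 <= a ^+ 2 * MMD2 k P Q
     + 2 * a * b * (kint k P Q - kint k P S - kint k Q Q + kint k Q S)
     + b ^+ 2 * MMD2 k Q S.
Proof.
have := psd_mixed hk_meas hk_rep hk_bd [:: (a, P); (b - a, Q); (- b, S)] [::].
congr (_ <= _).
rewrite /quad /pairing /MMD2 !big_cons !big_nil /= (kiC Q P) (kiC S P) (kiC S Q).
by ring.
Qed.

Lemma MMD2_ge0 (P Q : probability X R) : 0 <= MMD2 k P Q.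
Proof. by have [] := quad_form_cauchy_schwarz (mmd_form P Q Q). Qed.

Lemma MMD_triangle (P Q S : probability X R) :
  MMD k P S <= MMD k P Q + MMD k Q S.
Proof.
have [U0 V0 CS] := quad_form_cauchy_schwarz (mmd_form P Q S).
rewrite /MMD -(@ler_pXn2r _ 2) ?nnegrE ?addr_ge0 ?sqrtr_ge0//.
rewrite sqrrD !sqr_sqrtr ?MMD2_ge0//.
have -> : MMD2 k P S = MMD2 k P Q
    + (kint k P Q - kint k P S - kint k Q Q + kint k Q S) *+ 2 + MMD2 k Q S.
  by rewrite /MMD2; ring.
by rewrite lerD2r lerD2l lerMn2r.
Qed.

Definition centered (P0 : probability X R) (x y : X) : R :=
  k x y - kmean k P0 x - kmean k P0 y + kint k P0 P0.

Section Centered.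
Context (P0 : probability X R).
Local Notation kt := (centered P0).

Lemma centeredC x y : kt x y = kt y x.
Proof. by rewrite /centered (kC x y); ring. Qed.

Lemma bmf_centered x : bounded_measurable (kt x).
Proof.
have b1 : bounded_measurable (k x) := bmf_kernel hk_meas hk_bd x.
have b2 := bmfZ (-1) (bmf_kmean hk_meas hk_bd P0).
have b3 := bmf_cst X (- kmean k P0 x + kint k P0 P0).
have := bmfD (bmfD b1 b2) b3; congr bounded_measurable; apply/funext => y.
by rewrite /centered; ring.
Qed.

Lemma bmf_centered_diag : bounded_measurable (fun x => kt x x).
Proof.
have b1 := bmf_kernel_diag hk_meas hk_bd.
have b2 := bmfZ (-2) (bmf_kmean hk_meas hk_bd P0).
have := bmfD (bmfD b1 b2) (bmf_cst X (kint k P0 P0)); congr bounded_measurable; apply/funext => y.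
by rewrite /centered; ring.
Qed.

Lemma expect_centered x : \int[P0]_y kt x y = 0.
Proof.
have b1 : bounded_measurable (k x) := bmf_kernel hk_meas hk_bd x.
have bm := bmf_kmean hk_meas hk_bd P0.
have b2 := bmfZ (-1) bm.
have b3 := bmf_cst X (- kmean k P0 x + kint k P0 P0).
under eq_Rintegral => y _.
  have -> : kt x y = k x y + -1 * kmean k P0 y + (- kmean k P0 x + kint k P0 P0).
    by rewrite /centered; ring.
  over.
rewrite expectD//; last exact: bmfD.
rewrite expectD// expectZ// expect_cst -(kintE hk_meas hk_bd) -/(kmean k P0 x).
by ring.
Qed.

Lemma kmean_norm_le1 (P : probability X R) x : `|kmean k P x| <= 1.
Proof. by apply: expect_norm_le => //; exact: bmf_kernel. Qed.

Lemma kint_norm_le1 (P Q : probability X R) : `|kint k P Q| <= 1.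
Proof.
rewrite (kintE hk_meas hk_bd); apply: expect_norm_le; first exact: bmf_kmean.
exact: kmean_norm_le1.
Qed.

Lemma centered_norm_le4 x y : `|kt x y| <= 4.
Proof.
have T (a b c e : R) : `|a - b - c + e| <= `|a| + `|b| + `|c| + `|e|.
  rewrite (le_trans (ler_normD _ _))// lerD2r (le_trans (ler_normB _ _))// lerD2r.
  exact: ler_normB.
apply: (le_trans (T _ _ _ _)).
have := hk_bd x y; have := kmean_norm_le1 P0 x; have := kmean_norm_le1 P0 y.
have := kint_norm_le1 P0 P0; lra.
Qed.

(** The total weight stays arbitrary: total 1 gives [MMD2], while the parallelogram inequality needs
    partial and signed families. *)
Lemma quad_centered (t : seq (R * X)) : quad kt t = quad k t
  - 2 * (\sum_(p <- t) p.1) * (\sum_(p <- t) p.1 * kmean k P0 p.2)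
  + (\sum_(p <- t) p.1) ^+ 2 * kint k P0 P0.
Proof.
have L w x (s : seq (R * X)) : \sum_(p <- s) p.1 * (2 * w * kt x p.2) =
   \sum_(p <- s) p.1 * (2 * w * k x p.2)
   + 2 * w * ((kint k P0 P0 - kmean k P0 x) * (\sum_(p <- s) p.1)
              - \sum_(p <- s) p.1 * kmean k P0 p.2).
  elim: s => [|p s IH]; first by rewrite !big_nil; ring.
  by rewrite !big_cons IH /centered; ring.
elim: t => [|[w x] t IH]; first by rewrite /quad !big_nil; ring.
rewrite (quad_cons kC) (quad_cons centeredC) L IH !big_cons /= /centered.
by ring.
Qed.

(** Centring amounts to adding [P0] with minus the total weight as coefficient, so [psd_mixed]
    applies to the resulting signed measure. *)
Lemma quad_centered_ge0 (t : seq (R * X)) : 0 <= quad kt t.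
Proof.
have := psd_mixed hk_meas hk_rep hk_bd [:: (- \sum_(p <- t) p.1, P0)] t.
congr (_ <= _); rewrite quad_centered /pairing big_seq1 {2}/quad !big_seq1/=.
by ring.
Qed.

Lemma quad_cat_le (s t : seq (R * X)) :
  quad kt (s ++ t) <= 2 * quad kt s + 2 * quad kt t.
Proof.
pose neg (u : seq (R * X)) := [seq (- p.1, p.2) | p <- u].
pose bil u v := \sum_(p <- u) \sum_(q <- v) p.1 * q.1 * kt p.2 q.2.
have bilC u v : bil u v = bil v u.
  rewrite /bil exchange_big/=; apply: eq_bigr => p _; apply: eq_bigr => q _.
  by rewrite centeredC (mulrC q.1).
have bilN u v : bil u (neg v) = - bil u v.
  rewrite /bil -sumrN; apply: eq_bigr => p _.
  by rewrite big_map -sumrN; apply: eq_bigr => q _ /=; rewrite mulrN mulNr.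
have quadD u v : quad kt (u ++ v) = quad kt u + quad kt v + 2 * bil u v.
  rewrite /quad big_cat/=; under eq_bigr do rewrite big_cat.
  under [X in _ + X = _]eq_bigr do rewrite big_cat.
  by rewrite !big_split/= -/(bil u v) -/(bil v u) (bilC v u); ring.
have quadN u : quad kt (neg u) = quad kt u.
  by rewrite -[LHS]/(bil (neg u) (neg u)) bilN bilC bilN opprK.
(* Appending [neg t] realises the difference of the two parts, whose form is nonnegative; this
   bounds the cross term. *)
have := quad_centered_ge0 (s ++ neg t); rewrite !quadD bilN quadN.
by move=> H; lra.
Qed.

Lemma quad_centered_le (t : seq (R * X)) : (forall p, p \in map fst t -> 0 <= p) ->
  quad kt t <= 4 * (\sum_(p <- t) p.1) ^+ 2.
Proof.
move=> t0; elim: t t0 => [|[w x] t IH] t0.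
  by rewrite /quad !big_nil expr0n mulr0.
have w0 : 0 <= w by apply: t0; rewrite inE eqxx.
have {}t0 p : p \in map fst t -> 0 <= p by move=> pt; apply: t0; rewrite inE pt orbT.
have := IH t0; rewrite (quad_cons centeredC) big_cons /= sqrrD.
have S1 : \sum_(p <- t) p.1 * (2 * w * kt x p.2) <= 8 * w * \sum_(p <- t) p.1.
  elim: t t0 {IH} => [|[v y] t IH] t0; first by rewrite !big_nil mulr0.
  have v0 : 0 <= v by apply: t0; rewrite inE eqxx.
  have {}t0 p : p \in map fst t -> 0 <= p by move=> pt; apply: t0; rewrite inE pt orbT.
  rewrite !big_cons /= [leRHS]mulrDr lerD ?IH//.
  have := ler_normlW (centered_norm_le4 x y); have := mulr_ge0 v0 w0; nra.
have := ler_normlW (centered_norm_le4 x x); have := sqr_ge0 w; nra.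
Qed.

Lemma MMD2_wdirac (t : seq (R * X)) : (forall p, p \in map fst t -> 0 <= p) ->
  \sum_(p <- t) p.1 = 1 -> MMD2 k (wdirac_prob P0 t) P0 = quad kt t.
Proof.
move=> t0 t1.
have mk x := (bmf_kernel hk_meas hk_bd x).1.
have E f : bounded_measurable f -> \int[wdirac_prob P0 t]_x f x = \sum_(p <- t) p.1 * f p.2.
  by move=> [mf _]; exact: wdirac_prob_integral.
rewrite quad_centered t1 /MMD2 !(kintE hk_meas hk_bd) !E; try exact: bmf_kmean.
rewrite mulr1 expr1n mul1r; congr (_ - _ + _).
rewrite /quad; apply: eq_bigr => p _.
rewrite /kmean E; last exact: bmf_kernel.
by rewrite mulr_sumr; apply: eq_bigr => q _; rewrite mulrA.
Qed.

End Centered.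
End MMDTheory.

(** * Averaging over the iid data *)

Section IidGram.
Set Implicit Arguments. Unset Strict Implicit. Unset Printing Implicit Defensive.
Context (R : realType) (d : measure_display) (X : measurableType d).

(** Fixing the first sample [x] turns its cross terms with the later samples into the mean-zero
    function [2 * a * g x], which joins [f]. Only the diagonal, counted twice, survives. *)
Lemma iter_int_gram2 (P0 : probability X R) (g : X -> X -> R) (a : R) :
  (forall x y, g x y = g y x) -> (forall x, bounded_measurable (g x)) -> bounded_measurable (fun x => g x x) ->
  (forall x, \int[P0]_y g x y = 0) ->
  forall n (f : X -> R) (c : R), bounded_measurable f -> \int[P0]_x f x = 0 ->
  iter_int P0 n (fun xs => (a * gram2 g xs + \sum_(x <- xs) f x + c)%:E) =
  (a * (2 * n%:R * \int[P0]_x g x x) + c)%:E.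
Proof.
move=> gC bg bgd g0; elim=> [|n IH] f c bf f0.
  by rewrite /= /gram2 !big_nil; congr _%:E; ring.
rewrite /=.
have E x : iter_int P0 n (fun xs =>
     (a * gram2 g (x :: xs) + \sum_(x0 <- x :: xs) f x0 + c)%:E) =
  (a * (2 * n%:R * \int[P0]_x g x x) + c + (2 * a * g x x + f x))%:E.
  have b2 := bmfZ (2 * a) (bg x).
  transitivity (iter_int P0 n (fun xs =>
    (a * gram2 g xs + \sum_(y <- xs) (f y + 2 * a * g x y)
      + (c + (2 * a * g x x + f x)))%:E)).
    apply: eq_iter_int => xs _; rewrite (gram2_cons gC) big_cons big_split/= -mulr_sumr.
    by congr _%:E; ring.
  rewrite IH; [by congr _%:E; ring|exact: bmfD|].
  by rewrite expectD// expectZ// f0 g0 mulr0 addr0.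
under eq_integral do rewrite E.
have b1 := bmfZ (2 * a) bgd.
rewrite bmf_integral; last by apply: bmfD; [exact: bmf_cst|exact: bmfD].
rewrite expectD//; [|exact: bmf_cst|exact: bmfD].
rewrite expect_cst expectD// expectZ// f0; congr _%:E.
by rewrite -natr1; ring.
Qed.

End IidGram.

(** * The posterior bound *)

Section Concentration.
Set Implicit Arguments. Unset Strict Implicit. Unset Printing Implicit Defensive.
Context (R : realType) (d : measure_display) (X : measurableType d).
Context (k : X -> X -> R)
  (hk_meas : measurable_fun [set: X * X] (fun p : X * X => k p.1 p.2))
  (hk_rep : reproducing_kernel k) (hk_bd : forall x y, `|k x y| <= 1).
Local Notation mu := (@lebesgue_measure R).

Lemma zip_cat_drop (W : seq R) (xs xt : seq X) :
  zip W (xs ++ xt) = zip W xs ++ zip (drop (size xs) W) xt.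
Proof.
elim: xs W => [|x xs IH] [|w W] //=; first by case: (xt).
by rewrite IH.
Qed.

(** The infimum [C] may not be attained, so the left-hand side minus [2 * MMD k P P0] is shown to be
    a lower bound for every member of the family. *)
Lemma MMD_minimiser_le (Theta : Type) (Ptheta : Theta -> probability X R)
    (P0 P : probability X R) (C : R) (th : Theta) :
  ereal_inf [set (MMD k (Ptheta t) P0)%:E | t in [set: Theta]] = C%:E ->
  (forall t, MMD2 k P (Ptheta th) <= MMD2 k P (Ptheta t)) ->
  MMD k (Ptheta th) P0 <= C + 2 * MMD k P P0.
Proof.
move=> hinf hmin; rewrite -lerBlDr -lee_fin -hinf.
apply: le_ereal_inf_tmp => _ [t _ <-]; rewrite lee_fin lerBlDr.
have tri := MMD_triangle hk_meas hk_rep hk_bd.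
have symm Q S : MMD k Q S = MMD k S Q by rewrite /MMD (MMD2C hk_meas hk_rep hk_bd).
have mono : MMD k P (Ptheta th) <= MMD k P (Ptheta t) by rewrite ler_wsqrtr.
have := tri (Ptheta th) P P0; have := tri P P0 (Ptheta t).
rewrite (symm (Ptheta th) P) (symm P0 (Ptheta t)); lra.
Qed.

(** The auxiliary part is at most $2\cdot 4r^2\le 8r$ for its total weight $r\le 1$. Passing to r
    makes it linear in the weights, the form that the [rho] term of [dirichlet_moments] covers. *)
Lemma wdirac_MMD2_le (P0 : probability X R) (W : seq R) (xs xt : seq X) :
  size W = (size xs + size xt)%N -> (forall u, u \in W -> 0 <= u) ->
  \sum_(u <- W) u = 1 ->
  MMD2 k (wdirac_prob P0 (zip W (xs ++ xt))) P0 <=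
  2 * quad (centered k P0) (zip W xs) + 8 * \sum_(u <- drop (size xs) W) u.
Proof.
move=> sW W0 W1.
have fstZ : map fst (zip W (xs ++ xt)) = W.
  by apply: unzip1_zip; rewrite sW size_cat.
have fstD : map fst (zip (drop (size xs) W) xt) = drop (size xs) W.
  by apply: unzip1_zip; rewrite size_drop sW addKn.
have D0 u : u \in drop (size xs) W -> 0 <= u by move/mem_drop; exact: W0.
set r := \sum_(u <- drop _ _) u.
have r0 : 0 <= r by rewrite /r big_seq; apply: sumr_ge0 => u; exact: D0.
have r1 : r <= 1.
  rewrite -W1 -{1}(cat_take_drop (size xs) W) big_cat /= -/r lerDr.
  by rewrite big_seq; apply: sumr_ge0 => u /mem_take; exact: W0.
rewrite (MMD2_wdirac hk_meas hk_rep hk_bd); last 2 first.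
- by move=> p; rewrite fstZ; exact: W0.
- by rewrite -(big_map fst xpredT id) fstZ.
rewrite zip_cat_drop; apply: le_trans (quad_cat_le hk_meas hk_rep hk_bd _ _ _) _.
rewrite lerD2l.
have := @quad_centered_le _ _ _ _ hk_meas hk_rep hk_bd P0 (zip (drop (size xs) W) xt).
rewrite fstD -(big_map fst xpredT id) fstD -/r => /(_ D0) Q.
by apply: (@le_trans _ _ (2 * (4 * r ^+ 2))); [rewrite ler_pM2l|nra].
Qed.

Lemma dir_int_zero (a : nat -> R) (K : nat) (h : seq R -> \bar R) :
  fine (dir_const a K) = 0 -> dir_int a K h = 0%E.
Proof. by move=> E; rewrite /dir_int E invr0 mul0e. Qed.

Lemma dir_const_mixed (b : R) (n t : nat) : 0 < b ->
  dir_const (mixed_param b n) (n + t.+1) =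
  (dir_total (fun=> b) t * (rising_inv (t.+1%:R * b) n)%:E)%E.
Proof.
move=> b0; rewrite /dir_const addnS/= -dir_total_mixed//.
transitivity (iter_int mu (n + t) (fun v => (1 * dir_dens (mixed_param b n) (complete 1 v))%:E)).
  by apply: eq_iter_int => v _; rewrite mul1r.
by rewrite dir_mass// /pospow ltr01 powR1 mulr1 mule1.
Qed.

Section FixedSample.
Context (P0 : probability X R) (b c : R) (t : nat) (b0 : 0 < b) (c0 : 0 < c).
Context (cE : dir_total (fun=> b) t = c%:E).
Let al := t.+1%:R * b.

(** Markov's inequality with factor [ka], at fixed data. The hypothesis on [h] concerns probability
    vectors only, because the density vanishes as soon as one weight is not positive. *)
Lemma dir_int_bound (ka : R) (xs xt : seq X) (h : seq R -> R) : 0 <= ka ->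
  size xt = t.+1 ->
  (forall W, 0 <= h W) ->
  (forall W, size W = (size xs + size xt)%N -> (forall u, u \in W -> 0 <= u) ->
     \sum_(u <- W) u = 1 -> h W <= ka * MMD2 k (wdirac_prob P0 (zip W (xs ++ xt))) P0) ->
  (0 <= dir_int (mixed_param b (size xs)) (size xs + t.+1) (fun W => (h W)%:E) <=
  (2 * ka / ((al + (size xs)%:R) * (al + (size xs)%:R + 1))
     * gram2 (centered k P0) xs + 8 * ka * al / (al + (size xs)%:R))%:E)%E.
Proof.
move=> ka0 sxt h0 hle.
set n := size xs in hle *.
have al0 : 0 < al by rewrite mulr_gt0.
have ri0 := rising_inv_gt0 n al0.
have C0 : 0 < c * rising_inv al n by exact: mulr_gt0.
rewrite /dir_int dir_const_mixed// cE -EFinM /= addnS /=.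
pose g x y := 2 * ka * centered k P0 x y.
have gC x y : g x y = g y x by rewrite /g (centeredC hk_rep).
have quadg W : quad g W = 2 * ka * quad (centered k P0) W.
  rewrite /quad mulr_sumr; apply: eq_bigr => p _.
  by rewrite mulr_sumr; apply: eq_bigr => q _; rewrite /g; ring.
have gramg : gram2 g xs = 2 * ka * gram2 (centered k P0) xs.
  rewrite /gram2 mulrDr !mulr_sumr; congr (_ + _); apply: eq_bigr => p _ //.
  by rewrite mulr_sumr.
apply/andP; split.
  apply: mule_ge0; first by rewrite lee_fin invr_ge0 ltW.
  by apply: iter_int_ge0 => v _; rewrite mule_ge0 ?lee_fin ?dir_dens_ge0.
set V := (X in (_ <= X%:E)%E).
(* Writing the bound over the same normaliser reduces the claim to unnormalised integrals. *)
have -> : V%:E = ((c * rising_inv al n)^-1%:E * (c * rising_inv al n * V)%:E)%E.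
  by rewrite -EFinM mulKf// lt0r_neq0.
apply: lee_wpmul2l; first by rewrite lee_fin invr_ge0 ltW.
(* The factor [2 * ka] is put into the kernel [g] and [8 * ka] into [rho]; the linear term and the
   constant start at 0, the mass at 1. *)
have := dirichlet_moments gC (8 * ka) b0 cE xs (fun=> 0) 0 1.
rewrite -/n -/al /pospow ltr01 powR1 gramg => E.
set I := (X in X = _) in E.
apply: (@le_trans _ _ I).
  apply: le_iter_int => v sv.
  rewrite -[simplex_complete v]/(complete 1 v).
  set W := complete 1 v.
  have sW : size W = (n + size xt)%N by rewrite size_complete sv sxt addnS.
  rewrite -EFinM !lee_fin mulr_ge0 ?dir_dens_ge0//=.
  have [/allP W0|nW] := boolP (all (fun u => 0 < u) W); last first.
    by rewrite /dir_dens (negbTE nW) !mulr0.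
  have {}W0 u : u \in W -> 0 <= u by move/W0/ltW.
  apply: ler_wpM2r; first exact: dir_dens_ge0.
  apply: le_trans (hle _ sW W0 (sum_complete _ _)) _.
  rewrite quadg [X in _ + X + _ + _]big1 => [|p _]; last by rewrite mulr0.
  have := wdirac_MMD2_le P0 sW W0 (sum_complete _ _).
  by move/(ler_wpM2l ka0)/le_trans; apply; rewrite -/n le_eqVlt; apply/orP; left; apply/eqP; ring.
rewrite E lee_fin le_eqVlt; apply/orP; left; apply/eqP.
rewrite /V big1//; have A0 : 0 < al + n%:R by rewrite ltr_pwDl.
have A1 : 0 < al + n%:R + 1 by exact: addr_gt0.
by field; rewrite (gt_eqF A0) (gt_eqF A1).
Qed.

End FixedSample.
End Concentration.

Theorem theorem2 (R : realType) (d : measure_display) (X : measurableType d)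
  (k : X -> X -> R)
  (hk_meas : measurable_fun [set: X * X] (fun p : X * X => k p.1 p.2))
  (hk_rep : reproducing_kernel k)
  (hk_bd : forall x y, `|k x y| <= 1)
  (Theta : Type) (Ptheta : Theta -> probability X R)
  (P0 : probability X R) (C : R) (hC : 0 < C)
  (hinf : ereal_inf [set (MMD k (Ptheta t) P0)%:E | t in [set: Theta]] = C%:E)
  (theta_star : probability X R -> Theta)
  (htheta_min : forall (P : probability X R) (t : Theta),
      MMD2 k P (Ptheta (theta_star P)) <= MMD2 k P (Ptheta t))
  (htheta_meas : measurable_fun [set: pprobability X R]
      (fun P : pprobability X R => MMD k (Ptheta (theta_star P)) P0))
  (alpha : R) (halpha : 0 < alpha) (T : nat) (hT : (1 <= T)%N)
  (F : probability X R)
  (M : nat -> R) (hMpos : forall n, 0 < M n) (hM : M @ \oo --> +oo) :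
  (fun n : nat =>
     iter_int P0 n (fun xs =>
     iter_int F T (fun xt =>
     dir_int (fun i => if (i < n)%N then 1 else alpha / T%:R) (n + T)
       (fun w =>
          (\1_[set P : probability X R |
                 C + M n / Num.sqrt n%:R < MMD k (Ptheta (theta_star P)) P0]
              (wdirac_prob P0 (zip w (xs ++ xt))))%:E))))
  @ \oo --> 0%E.
Proof.
case: T hT => // t _.
pose b := alpha / t.+1%:R.
have b0 : 0 < b by rewrite divr_gt0.
have alE : t.+1%:R * b = alpha by rewrite /b mulrC divfK ?pnatr_eq0.
pose ev n := [set P : probability X R |
  C + M n / Num.sqrt n%:R < MMD k (Ptheta (theta_star P)) P0].
pose h n (xs xt : seq X) (w : seq R) : R := \1_(ev n) (wdirac_prob P0 (zip w (xs ++ xt))).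
pose u n := iter_int P0 n (fun xs => iter_int F t.+1 (fun xt =>
  dir_int (mixed_param b n) (n + t.+1) (fun w => (h n xs xt w)%:E))).
change (u @ \oo --> 0%E).
(* The mass of the auxiliary weights is never shown to be positive and finite: otherwise
   [dir_int] is 0, because [fine +oo = 0] and [0^-1 = 0]. *)
have [|[c c0 cE]] : fine (dir_total (fun=> b) t) = 0 \/
    exists2 c, 0 < c & dir_total (fun=> b) t = c%:E.
  have := dir_total_ge0 (fun=> b) t; case: (dir_total _ t) => [r|_|//]; last by left.
  by rewrite lee_fin le_eqVlt => /orP[/eqP <-|r0]; [left|right; exists r].
  move=> c0; apply: cvg_near_cst; apply: nearW => n.
  have Z : fine (dir_const (mixed_param b n) (n + t.+1)) = 0.
    rewrite dir_const_mixed//; have := dir_total_ge0 (fun=> b) t; move: c0.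
    case: (dir_total _ t) => [r|_ _|//] /=; first by move=> ->; rewrite mul0r.
    by rewrite gt0_mulye// lte_fin rising_inv_gt0// mulr_gt0.
  rewrite /u -[RHS](iter_int_cst P0 n 0); apply: eq_iter_int => xs _.
  rewrite -[RHS](iter_int_cst F t.+1 0); apply: eq_iter_int => xt _.
  by rewrite dir_int_zero.
pose kt := centered k P0.
(* The 4 is that of [ka]. The data part contributes $4nD/((\alpha+n)(\alpha+n+1))\le 16/n$, as the
   mean diagonal D is at most 4, and the auxiliary mass at most $8\alpha/n$; the factor n in [ka]
   cancels both denominators. *)
pose K := 4 * (16 + 8 * alpha).
have bound n : (0 < n)%N -> (0 <= u n <= (K * (M n)^-1 ^+ 2)%:E)%E.
  move=> n0; have nR : 0 < n%:R :> R by rewrite ltr0n.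
  have Mn := hMpos n.
  (* On the event, $M_n/\sqrt n<2\,\mathrm{MMD}(P,P_0)$; squaring shows that the indicator is at
     most [ka] times [MMD2]. *)
  pose ka := 4 * n%:R / M n ^+ 2.
  have ka0 : 0 < ka by rewrite divr_gt0 ?exprn_gt0// mulr_gt0.
  pose a := 2 * ka / ((alpha + n%:R) * (alpha + n%:R + 1)).
  pose e := 8 * ka * alpha / (alpha + n%:R).
  have inner xs xt : size xs = n -> size xt = t.+1 ->
     (0 <= dir_int (mixed_param b n) (n + t.+1) (fun w => (h n xs xt w)%:E)
        <= (a * gram2 kt xs + e)%:E)%E.
    move=> sxs sxt.
    have := @dir_int_bound _ _ _ _ hk_meas hk_rep hk_bd P0 b c t b0 c0 cE
      ka xs xt (h n xs xt) (ltW ka0) sxt.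
    rewrite alE sxs; apply => [W|W sW W0 W1]; first by rewrite /h indicE.
    rewrite /h indicE; case: (boolP (_ \in _)) => [|_]; last first.
      by rewrite mulr_ge0 ?(ltW ka0)// (MMD2_ge0 hk_meas hk_rep hk_bd).
    set P := wdirac_prob _ _; rewrite inE /ev /= => evP.
    have le1 : M n / Num.sqrt n%:R < 2 * MMD k P P0.
      have := @MMD_minimiser_le _ _ _ _ hk_meas hk_rep hk_bd Theta Ptheta P0 P C
        (theta_star P) hinf (htheta_min P).
      by move/(lt_le_trans evP); rewrite ltrD2l.
    have sn0 : 0 < Num.sqrt n%:R :> R by rewrite sqrtr_gt0.
    have m0 : 0 <= MMD2 k P P0 by exact: (MMD2_ge0 hk_meas hk_rep hk_bd).
    have mE : MMD2 k P P0 = MMD k P P0 ^+ 2 by rewrite sqr_sqrtr.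
    have le2 : M n < 2 * MMD k P P0 * Num.sqrt n%:R by rewrite -ltr_pdivrMr.
    have le3 : M n ^+ 2 <= (2 * MMD k P P0 * Num.sqrt n%:R) ^+ 2.
      by rewrite lerXn2r ?nnegrE ?(ltW Mn)// ltW// (lt_trans Mn).
    rewrite /ka mE mulrAC ler_pdivlMr ?exprn_gt0// mul1r.
    apply: (le_trans le3); rewrite !exprMn (sqr_sqrtr (ltW nR)).
    by rewrite le_eqVlt; apply/orP; left; apply/eqP; ring.
  have mid xs : size xs = n ->
    (0 <= iter_int F t.+1 (fun xt =>
       dir_int (mixed_param b n) (n + t.+1) (fun w => (h n xs xt w)%:E))
     <= (a * gram2 kt xs + e)%:E)%E.
    move=> sxs; apply/andP; split.
      by apply: iter_int_ge0 => xt sxt; have /andP[] := inner xs xt sxs sxt.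
    (* The bound is free of the auxiliary points, so averaging it over [F] leaves it unchanged. *)
    rewrite -[leRHS](iter_int_cst F t.+1).
    by apply: le_iter_int => xt sxt; exact: inner.
  apply/andP; split.
    by apply: iter_int_ge0 => xs sxs; have /andP[] := mid xs sxs.
  apply: le_trans (le_iter_int _ _) _; first by move=> xs sxs; exact: (mid xs sxs).
  have bz : bounded_measurable (fun=> 0 : R) := bmf_cst X 0.
  have := @iter_int_gram2 _ _ _ P0 kt a (centeredC hk_rep P0)
    (bmf_centered hk_meas hk_bd P0) (bmf_centered_diag hk_meas hk_bd P0)
    (expect_centered hk_meas hk_bd P0) n (fun=> 0) e bz (expect_cst P0 0).
  have -> : iter_int P0 n (fun xs => (a * gram2 kt xs + \sum_(x <- xs) 0 + e)%:E) =
     iter_int P0 n (fun xs => (a * gram2 kt xs + e)%:E).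
    by apply: eq_iter_int => xs _; rewrite big1// addr0.
  move=> ->; rewrite lee_fin.
  set D := \int[P0]_x kt x x.
  have D4 : D <= 4.
    apply: le_trans (ler_norm _) _; apply: expect_norm_le.
      exact: (bmf_centered_diag hk_meas hk_bd P0).
    by move=> x; exact: (centered_norm_le4 hk_meas hk_bd).
  have an0 : 0 < alpha + n%:R by exact: addr_gt0.
  have an1 : 0 < alpha + n%:R + 1 by exact: addr_gt0.
  have le1 : a * (2 * n%:R * D) <= ka * (16 / n%:R).
    have -> : a * (2 * n%:R * D) =
      ka * (4 * n%:R * D / ((alpha + n%:R) * (alpha + n%:R + 1))).
      by rewrite /a; field; rewrite (gt_eqF an0) (gt_eqF an1).
    rewrite ler_pM2l// ler_pdivrMr ?mulr_gt0// [leRHS]mulrAC ler_pdivlMr//.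
    have : n%:R * D * n%:R <= n%:R * 4 * n%:R by rewrite ler_pM2r// ler_pM2l.
    have := halpha; move: nR; nra.
  have le2 : e <= ka * (8 * alpha / n%:R).
    have -> : e = ka * (8 * alpha / (alpha + n%:R)) by rewrite /e; ring.
    rewrite ler_pM2l// ler_pM2l ?mulr_gt0// lef_pV2 ?posrE//.
    by rewrite lerDr ltW.
  apply: (le_trans (lerD le1 le2)).
  rewrite le_eqVlt; apply/orP; left; apply/eqP; rewrite /ka /K.
  by field; rewrite (gt_eqF nR) (gt_eqF Mn).
apply: (@squeeze_cvge _ _ _ _ (cst 0%E) _ (fun n => (K * (M n)^-1 ^+ 2)%:E)).
- by near=> n; apply: bound; near: n; exists 1%N.
- exact: cvg_cst.
- apply: cvg_EFin; first exact: nearW.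
  rewrite -[X in _ --> X](mulr0 K); apply: cvgMl_tmp.
  have iv : (M n)^-1 @[n --> \oo] --> (0 : R).
    by apply/gtr0_cvgV0 => //; apply: nearW.
  rewrite -[X in _ --> X](mulr0 0); under eq_fun do rewrite expr2; exact: cvgM.
Unshelve. all: by end_near. Qed.
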